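(* Let $\Gamma$ be a Moore graph of diameter two and degree $57$, and let $x\in\operatorname{Aut}(\Gamma)$ be an automorphism of prime order $p\in\{7,11,13,19\}$. Then: \begin{itemize} \item if $p=7$, then $a_0(x)\in\{2,9,16,23,30,37\}$ and $a_1(x)=7a_0(x)+35$; \item if $p=11$, then $a_0(x)=5$ and $a_1(x)=55$; \item if $p=13$, then $a_0(x)=0$ and $a_1(x)=65$; \item if $p=19$, then $a_0(x)=1$ and $a_1(x)=57$. \end{itemize}
   Context: Graphs are finite, simple and undirected. A Moore graph of diameter two and degree $57$ is a $57$-regular graph of diameter two on $1+57^2=3250$ vertices; equivalently, a strongly regular graph with parameters $(3250,57,0,1)$: a $57$-regular graph on $3250$ vertices in which any two adjacent vertices have no common neighbour and any two distinct non-adjacent vertices have exactly one common neighbour. For an automorphism $x$, $a_i(x)=|\{u\in V(\Gamma): d(u,x(u))=i\}|$, where $d$ is the graph distance; thus $a_0(x)$ is the number of vertices fixed by $x$ and $a_1(x)$ is the number of vertices adjacent to their image under $x$. *)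

(* Defs.v *)
From mathcomp Require Import all_boot all_fingroup.

Set Implicit Arguments.
Unset Strict Implicit.
Unset Printing Implicit Defensive.

Record sgraph := SGraph {
  vertex :> finType;
  adj : rel vertex;
  adj_sym : symmetric adj;
  adj_irrefl : irreflexive adj
}.

Section Graph.

Variable G : sgraph.

Definition walk (n : nat) (u v : G) : bool :=
  [exists w : n.-tuple G, path (@adj G) u w && (last u w == v)].

(* Least length of a walk from u to v. A shortest walk has length less than
   #|G|, so vertices in distinct components get the out-of-range value #|G|. *)
Definition dist (u v : G) : nat := find (fun n => walk n u v) (iota 0 #|G|).

Definition connected : Prop := forall u v : G, connect (@adj G) u v.

Definition diameter : nat := \max_(u : G) \max_(v : G) dist u v.

Definition regular (k : nat) : Prop := forall u : G, #|[set v | adj u v]| = k.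

Definition graph_aut : {set {perm G}} :=
  [set s : {perm G} | [forall u, forall v, adj (s u) (s v) == adj u v]].

Definition displaced (i : nat) (x : {perm G}) : nat :=
  #|[set u : G | dist u (x u) == i]|.

(* Moore graph of diameter two and degree k: it attains the bound 1 + k ^ 2 on
   the number of vertices. *)
Definition moore_diameter2 (k : nat) : Prop :=
  [/\ regular k, connected, diameter = 2 & #|G| = 1 + k ^ 2].

End Graph.

Notation "''a_' i" := (@displaced _ i) (at level 8, i at level 2, format "''a_' i").

(* Main.v *)
Require Import Defs.
From HB Require Import structures.
From mathcomp Require Import all_boot all_fingroup all_order all_algebra.
From mathcomp Require Import all_solvable all_field.
From mathcomp Require Import ring zify.

Set Implicit Arguments.
Unset Strict Implicit.
Unset Printing Implicit Defensive.

Import GRing.Theory Num.Theory.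

(** Let A be the adjacency matrix of the graph and J the all-ones matrix.  From
    A^2 + A - 56 = J and AJ = JA = 57 J one gets (D - 350)(D + 400) = 0 for
    D = 50 A - J: subtracting a multiple of J moves the eigenvalue 57 onto -8.
    Moreover the trace of D times the permutation matrix of x ^ k is
    50 * a_1(x ^ k) - 3250, so counting vertices adjacent to their image is a
    trace computation for a matrix that commutes with x and has two eigenvalues.

    The engine is [trace_formula].  If x has prime order p and the eigenvalues a
    and b of D are distinct mod p, then this trace equals al * a + be * b, where
    al and be are the multiplicities of a and b in the characteristic polynomial
    mod p of the restriction of D to the fixed points of x.  This is the
    statement that the two eigenlattices over the p-adic integers are direct sums
    of trivial and free modules for the cyclic group generated by x, the trivial
    summands being seen on the fixed points.  The proof is elementary: let D act
    on functions h with h (x v) = h v and on functions with h (x v) = z * h v for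
    z a primitive p-th root of unity.  Bases indexed by orbits give two matrices,
    both killed by (T - a)(T - b).  Mod p the first is block triangular, with
    diagonal blocks D on the fixed points and the reduction at z = 1 of the
    second.  Comparing characteristic polynomials and traces gives the formula.

    For the graph it reads a_1 + 8 a_0 = 65 + 15 al with al <= a_0
    ([shifted_trace]), valid for every x ^ k with k prime to p.

    The other ingredient is the fixed subgraph.  It contains the common
    neighbour of any two of its non-adjacent vertices, and its degrees are 57
    mod p.  If all of them are at least 2 it is regular of some degree d with
    1 + d^2 vertices, and counting the vertices adjacent to it leaves d <= 8 or
    d = 57.  For p = 11 this gives a_0 = 5; for p = 19 it leaves a single vertex;
    for p = 13 it leaves no vertex, since degree 5 is excluded by the
    irrationality of its eigenvalues.  Since p divides a_1, the range 0 <= al <= a_0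
    then leaves one value of al in each of these three cases.

    For p = 7, degree 8 forces a_1 = 0, against the trace formula, so the fixed
    subgraph is a star.  Mod 7 the matrix D of a star has rank at most 2, so
    al >= a_0 - 2; as 7 divides al and a_0 - 2, equality holds and
    a_1 = 7 a_0 + 35.  Finally the sets of vertices adjacent to their images under
    x, x^2 and x^3 have this same size, are disjoint, and avoid the fixed
    vertices and their neighbours, which bounds a_0 by 40. *)

Local Open Scope ring_scope.

(** * Characteristic polynomials *)

Lemma char_poly_splits (n : nat) (M : 'M[algC]_n) :
  exists r : seq algC,
    [/\ char_poly M = \prod_(z <- r) ('X - z%:P), size r = n,
        {in r, forall z, eigenvalue M z} & \tr M = \sum_(z <- r) z].
Proof.
have [r rE] := closed_field_poly_normal (char_poly M).
rewrite (monicP (char_poly_monic M)) scale1r in rE.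
have szr : size r = n.
  by apply: succn_inj; rewrite -(size_char_poly M) rE size_prod_XsubC.
exists r; split=> // [z zr|].
  by rewrite eigenvalue_root_char rE root_prod_XsubC.
case: n M rE szr => [|n] M rE szr.
  by rewrite /mxtrace big_ord0; case: r szr {rE}; rewrite // big_nil.
apply: oppr_inj; rewrite -char_poly_trace // rE -[in LHS]szr.
by rewrite coefPn_prod_XsubC // szr.
Qed.

(** All roots of the characteristic polynomial are eigenvalues, hence a or b.
    Only the multiplicities and the trace matter, so the matrix is not
    diagonalized. *)
Lemma char_poly_quadratic (n : nat) (M : 'M[algC]_n) (a b : algC) :
    a != b -> M *m M = (a + b) *: M - (a * b)%:M ->
  exists f g : nat,
    [/\ (f + g)%N = n, char_poly M = ('X - a%:P) ^+ f * ('X - b%:P) ^+ g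
      & \tr M = a *+ f + b *+ g].
Proof.
move=> neq_ab M2; have [r [-> szr rP ->]] := char_poly_splits M.
have {rP} : {in r, forall z, (z == a) || (z == b)}.
  move=> z /rP/eigenvalueP[v vM v_neq0].
  have : (z - a) * (z - b) *: v = 0.
    have : v *m (M *m M) = v *m ((a + b) *: M - (a * b)%:M) by rewrite M2.
    rewrite mulmxA mulmxBr -scalemxAr mul_mx_scalar !vM -scalemxAl vM !scalerA.
    rewrite -scalerBl => /eqP; rewrite -subr_eq0 -scalerBl => /eqP vE.
    by rewrite -[RHS]vE; congr (_ *: _); ring.
  by move/eqP; rewrite scaler_eq0 (negPf v_neq0) orbF mulf_eq0 !subr_eq0.
elim: r n szr {M M2} => [|z r IHr] n szr rP.
  by exists 0%N, 0%N; rewrite !big_nil !expr0 mulr1 !mulr0n addr0 -szr; split.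
have [|f [g [fg rE tE]]] := IHr _ erefl.
  by move=> y yr; apply: rP; rewrite inE yr orbT.
have /orP[/eqP->|/eqP->] := rP z (mem_head _ _).
  exists f.+1, g; rewrite !big_cons rE tE -szr /= -fg; split=> //.
    by rewrite exprS mulrA.
  by rewrite mulrS addrA.
exists f, g.+1; rewrite !big_cons rE tE -szr /= -fg addnS; split=> //.
  by rewrite exprS mulrCA.
by rewrite mulrS addrCA.
Qed.

Lemma char_poly_lblock (R : comNzRingType) m n (A : 'M[R]_m) (C : 'M[R]_(n, m))
    (E : 'M[R]_n) :
  char_poly (block_mx A 0 C E) = char_poly A * char_poly E.
Proof.
rewrite /char_poly /char_poly_mx map_block_mx scalar_mx_block opp_block_mx.
by rewrite add_block_mx map_mx0 oppr0 addr0 det_lblock.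
Qed.

(** Sylvester's identity: both sides are computed from the determinant of the
    block matrix with rows (X, U) and (W, 1), multiplied on the right, then on
    the left, by a block triangular matrix that clears W. *)
Lemma char_poly_mulmxC (R : comNzRingType) m n (U : 'M[R]_(m, n)) (W : 'M[R]_(n, m)) :
  char_poly (U *m W) * 'X ^+ n = 'X ^+ m * char_poly (W *m U).
Proof.
pose U' := map_mx polyC U; pose W' := map_mx polyC W.
pose B := block_mx ('X%:M) U' W' (1%:M) : 'M[{poly R}]_(m + n).
have E1 : char_poly (U *m W) = \det B.
  have : \det (B *m block_mx 1%:M 0 (- W') 1%:M) = \det B.
    by rewrite det_mulmx det_lblock !det1 !mulr1.
  rewrite mulmx_block !mulmx1 !mulmx0 !add0r mul1mx subrr det_ublock det1 mulr1.
  by move <-; rewrite /char_poly /char_poly_mx map_mxM mulmxN.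
have : \det (block_mx 1%:M 0 (- W') ('X%:M) *m B) = 'X ^+ n * \det B.
  by rewrite det_mulmx det_lblock det1 mul1r det_scalar.
rewrite mulmx_block !mul1mx !mul0mx !addr0 !mulmx1 mulNmx mul_mx_scalar.
rewrite mul_scalar_mx addNr det_ublock det_scalar => E2.
rewrite E1 mulrC -E2; congr (_ * \det _).
by rewrite /char_poly_mx map_mxM mulNmx addrC.
Qed.

Lemma sqr17_irrational (m n : nat) : (17 * m ^ 2 = n ^ 2)%N -> m = 0%N.
Proof.
(* The exponent of 17 is odd on the left and even on the right. *)
move=> E; case: m E => // m E; have n_gt0 : (0 < n)%N by case: n E.
have := congr1 (logn 17) E; rewrite lognM // !lognX /=.
by move=> /(congr1 odd); rewrite oddD !oddM.
Qed.

(** The Hoffman-Singleton argument in degree 5, where the eigenvalues other than 5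
    are (-1 + s) / 2 and (-1 - s) / 2 with s^2 = 17.  As s is irrational, a zero
    trace forces these two to have the same multiplicity b; the trace then gives
    b = 5 e with e the multiplicity of 5, whence n = e + 2 b = 11 e. *)
Lemma trace0_dvd11 n (M : 'M[algC]_n) : \tr M = 0 ->
    (forall z, eigenvalue M z -> (z - 5) * (z ^+ 2 + z - 4) = 0) ->
  (11 %| n)%N.
Proof.
move=> tr0 eigM; have [r [_ szr rP trE]] := char_poly_splits M.
pose s : algC := sqrtC 17; have s2 : s ^+ 2 = 17 by rewrite sqrtCK.
have {rP eigM} rP : {in r, forall z, (z - 5) * (z ^+ 2 + z - 4) = 0}.
  by move=> z /rP/eigM.
have [e [b [c [ebc sumE]]]] : exists e b c : nat, (e + b + c)%N = n /\
    2 * \sum_(z <- r) z = 10 * e%:R - (b + c)%:R + (b%:R - c%:R) * s.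
  elim: r n {M tr0 trE} szr rP => [|z r IHr] n szr rP.
    by exists 0%N, 0%N, 0%N; rewrite big_nil !mulr0 subrr mul0r !addr0; split.
  have [|e [b [c [ebc E]]]] := IHr _ erefl.
    by move=> y yr; apply: rP; rewrite inE yr orbT.
  rewrite big_cons -szr /= -ebc mulrDr E.
  have : (z - 5) * ((2 * z + 1 - s) * (2 * z + 1 + s)) = 0.
    transitivity (4 * ((z - 5) * (z ^+ 2 + z - 4)) + (z - 5) * (17 - s ^+ 2)).
      by ring.
    by rewrite rP ?mem_head // s2 subrr !mulr0 addr0.
  move/eqP; rewrite !mulf_eq0 => /or3P[] /eqP zE.
  - exists e.+1, b, c; split; first by lia.
    have -> : z = 5 by apply/eqP; rewrite -subr_eq0 zE.
    by rewrite -(natr1 e); ring.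
  - exists e, b.+1, c; split; first by lia.
    have -> : 2 * z = s - 1 by apply/eqP; rewrite -subr_eq0 -zE; apply/eqP; ring.
    by rewrite addSn -(natr1 (b + c)) -(natr1 b); ring.
  - exists e, b, c.+1; split; first by lia.
    have -> : 2 * z = - s - 1 by apply/eqP; rewrite -subr_eq0 -zE; apply/eqP; ring.
    by rewrite addnS -(natr1 (b + c)) -(natr1 c); ring.
have E : (c%:R - b%:R) * s = 10 * e%:R - (b + c)%:R :> algC.
  move: sumE; rewrite -trE tr0 mulr0 => sumE; rewrite -[RHS]subr0 sumE.
  by ring.
have {}E : 17 * (c%:Z - b%:Z) ^+ 2 = (10 * e%:Z - (b + c)%:Z) ^+ 2.
  apply: (@intr_inj algC); rewrite rmorphM !rmorphXn /= !rmorphB /= rmorphM /=.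
  by rewrite -!pmulrn -E exprMn s2 mulrC.
have cb : absz (c%:Z - b%:Z)%R = 0%N.
  apply: (@sqr17_irrational _ (absz (10 * e%:Z - (b + c)%:Z)%R)).
  by move: E; rewrite -!abszX => /(congr1 absz); rewrite abszM.
have cbE : c = b by lia.
have eE : (10 * e = 2 * b)%N.
  by move: E; rewrite cbE subrr expr0n mulr0 => /esym/eqP; rewrite expf_eq0 /=; lia.
by apply/dvdnP; exists e; lia.
Qed.

(** * Integer polynomials at a root of unity of prime order *)

Lemma prim_root_prime_sum (p : nat) (z : algC) :
  prime p -> p.-primitive_root z -> \sum_(i < p) z ^+ i = 0.
Proof.
move=> p_pr zP; have p_gt1 := prime_gt1 p_pr.
have z_neq1 : z - 1 != 0.
  rewrite subr_eq0; apply/eqP => z1.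
  by have := prim_order_dvd zP 1; rewrite z1 expr1n eqxx gtnNdvd.
by apply: (mulfI z_neq1); rewrite mulr0 -subrX1 (prim_expr_order zP) subrr.
Qed.

(** The p-th cyclotomic polynomial is the minimal polynomial of z over the
    rationals; being monic, it already divides over the integers.  The remainder of
    the division vanishes at z and is too short to be nonzero. *)
Lemma prim_root_prime_dvd (p : nat) (z : algC) (q : {poly int}) :
    prime p -> p.-primitive_root z -> root (map_poly intr q) z ->
  exists s, q = s * \sum_(i < p) 'X^i.
Proof.
move=> p_pr zP qz; have p_gt0 := prime_gt0 p_pr.
pose Phi : {poly int} := \sum_(i < p) 'X^i.
have PhiE : Phi = \poly_(i < p) 1.
  by rewrite poly_def; apply: eq_bigr => i _; rewrite scale1r.
have szPhi : size Phi = p by rewrite PhiE size_poly_eq ?oner_eq0.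
have monPhi : Phi \is monic.
  by rewrite monicE lead_coefE szPhi PhiE coef_poly ltn_predL p_gt0.
have Phiz : root (map_poly intr Phi) z.
  apply/eqP; rewrite rmorph_sum horner_sum -[RHS](prim_root_prime_sum p_pr zP).
  by apply: eq_bigr => i _; rewrite rmorphXn /= map_polyX hornerXn.
pose r := q %% Phi; exists (q %/ Phi).
rewrite -/Phi {1}(Pdiv.IdomainMonic.divp_eq monPhi q) -/r.
suff -> : r = 0 by rewrite addr0.
have rz : root (map_poly intr r) z.
  move: qz; rewrite {1}(Pdiv.IdomainMonic.divp_eq monPhi q) -/r.
  by rewrite rmorphD rmorphM /= /root hornerD hornerM (eqP Phiz) mulr0 add0r.
have szr : (size r < p)%N by rewrite -szPhi ltn_modpN0 // monic_neq0.
have [m [mE m_mon mP]] := minCpolyP z.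
have szm : size m = p.
  rewrite -(size_map_poly (ratr : rat -> algC)) -mE (minCpoly_cyclotomic zP).
  by rewrite size_cyclotomic totient_prime // prednK.
apply/eqP; apply: contraLR szr => r_neq0; rewrite -leqNgt -szm.
have -> : size r = size (map_poly intr r : {poly rat}).
  by rewrite size_map_inj_poly ?rmorph0 //; apply: intr_inj.
apply: dvdp_leq.
  by rewrite map_poly_eq0_id0 ?intr_eq0 ?lead_coef_eq0.
rewrite -mP -map_poly_comp (eq_map_poly (g := intr)) // => a /=.
by rewrite ratr_int.
Qed.

Definition int_eval (R : comNzRingType) (z : R) : {poly int} -> R :=
  horner_morph (fun c : int => mulrC z c%:~R).
HB.instance Definition _ (R : comNzRingType) (z : R) :=
  GRing.RMorphism.on (int_eval z).

Lemma int_evalC (R : comNzRingType) (z : R) (c : int) : int_eval z c%:P = c%:~R.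
Proof. exact: horner_morphC. Qed.

Lemma int_evalX (R : comNzRingType) (z : R) : int_eval z 'X = z.
Proof. exact: horner_morphX. Qed.

Lemma int_eval_sum (R : comNzRingType) (z : R) n (c : nat -> int) :
  int_eval z (\sum_(k < n) c k *: 'X^k) = \sum_(k < n) (c k)%:~R * z ^+ k.
Proof.
rewrite rmorph_sum; apply: eq_bigr => k _.
by rewrite -mul_polyC rmorphM rmorphXn /= int_evalC int_evalX.
Qed.

(** The congruence of z and 1 modulo the prime above p, without cyclotomic
    integers: an integer polynomial vanishing at z is a multiple of
    1 + X + ... + X^(p - 1), whose value at 1 is p. *)
Lemma int_eval_prim_root (p : nat) (z : algC) (q : {poly int}) :
  prime p -> p.-primitive_root z -> int_eval z q = 0 -> int_eval (1 : 'F_p) q = 0.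
Proof.
move=> p_pr zP /eqP qz.
have [s ->] := prim_root_prime_dvd p_pr zP qz.
rewrite rmorphM rmorph_sum /=; under eq_bigr => i _ do
  rewrite rmorphXn /= int_evalX expr1n.
by rewrite sumr_const card_ord (pchar_Fp_0 p_pr) mulr0.
Qed.

(** * Orbits of a permutation of prime order *)

Section Orbits.

Variables (V : finType) (x : {perm V}) (p : nat).
Hypotheses (p_pr : prime p) (ox : #[x]%g = p).

Lemma permX_fixed (v : V) (k : nat) : x v = v -> (x ^+ k)%g v = v.
Proof. by move=> xv; elim: k => [|k IHk]; rewrite ?perm1 // expgSr permM IHk. Qed.

Lemma permX_mod (v : V) (k : nat) : (x ^+ (k %% p))%g v = (x ^+ k)%g v.
Proof. by rewrite -ox expg_mod_order. Qed.

Lemma permX_fix_dvd (v : V) (k : nat) : x v != v -> (x ^+ k)%g v = v -> (p %| k)%N.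
Proof.
move=> xv xkv; apply: contraNT xv; rewrite -prime_coprime // => cpk.
have [m /eqP mE] : exists m, (k * m == 1 %[mod p])%N.
  have k_gt0 : (0 < k)%N.
    by case: k cpk {xkv} => //; rewrite /coprime gcdn0 (gtn_eqF (prime_gt1 p_pr)).
  have [m n mE _] := egcdnP p k_gt0; exists m.
  by rewrite mulnC mE gcdnC (eqP cpk) modnMDl.
have xmv : ((x ^+ k) ^+ m)%g v = v.
  by elim: m {mE} => [|m IHm]; rewrite ?perm1 // expgSr permM IHm.
by rewrite -[in x v](expg1 x) -permX_mod -mE permX_mod expgM xmv.
Qed.

(** A free choice of coordinates on the moved points: each of them is
    x ^ k (r j) for exactly one pair (j, k).  All later sums over orbits go
    through this parametrization. *)
Lemma orbit_representatives :
  exists (N : nat) (r : 'I_N -> V),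
    let xr := fun jk : 'I_N * 'I_p => (x ^+ jk.2)%g (r jk.1) in
    injective xr /\ (forall v, (x v != v) = (v \in codom xr)).
Proof.
have xI : injective x by apply: perm_inj.
have xC := fconnect_sym xI.
have rootX k v : froot x ((x ^+ k)%g v) = froot x v.
  by apply/eqP; rewrite permX eq_sym (root_connect xC) fconnect_iter.
have fixX k v : (x ((x ^+ k)%g v) == (x ^+ k)%g v) = (x v == v).
  by rewrite -permM -expgSr expgS permM (inj_eq perm_inj).
pose R := [set v | (x v != v) && (froot x v == v)].
exists #|R|, (fun j => enum_val j) => /=; split=> [[i k] [j l] /= E|v].
  have repP (m : 'I_#|R|) :
      x (enum_val m) != enum_val m /\ froot x (enum_val m) = enum_val m.
    by have := enum_valP m; rewrite inE => /andP[xm /eqP].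
  have [_ ri] := repP i; have [xj rj] := repP j.
  have ij : i = j by apply: enum_val_inj; rewrite -ri -rj -(rootX k) E rootX.
  rewrite ij in E *; congr (_, _).
  wlog le_kl : k l E / (k <= l)%N.
    by move=> W; case/orP: (leq_total k l) => /W-> //.
  have /(permX_fix_dvd xj) : (x ^+ (l - k))%g (enum_val j) = enum_val j.
    apply: (@perm_inj _ (x ^+ k)%g); rewrite -permM -expgD subnK // E.
  rewrite /dvdn modn_small ?(leq_ltn_trans (leq_subr _ _)) // subn_eq0 => le_lk.
  by apply/val_inj/eqP; rewrite eqn_leq le_kl.
apply/idP/codomP => [xv|[[j k] /= ->]]; last first.
  by rewrite fixX; have := enum_valP j; rewrite inE => /andP[].
have rR : froot x v \in R.
  rewrite inE (root_root xC) eqxx andbT.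
  have /iter_findex <- : fconnect x v (froot x v) by apply: connect_root.
  by rewrite -permX fixX.
have /iter_findex : fconnect x (froot x v) v by rewrite xC connect_root.
rewrite -permX -permX_mod => vE.
exists (enum_rank_in rR (froot x v),
        Ordinal (ltn_pmod (findex x (froot x v) v) (prime_gt0 p_pr))).
by rewrite /= enum_rankK_in.
Qed.

End Orbits.

(** * The trace formula *)

Lemma split_lshift m n (i : 'I_m) : split (lshift n i) = inl i.
Proof. exact: (unsplitK (inl i)). Qed.

Lemma split_rshift m n (j : 'I_n) : split (rshift m j) = inr j.
Proof. exact: (unsplitK (inr j)). Qed.

Section Kernel.

Variables (V : finType) (x : {perm V}) (p : nat).
Hypotheses (p_pr : prime p) (ox : #[x]%g = p).
Variables (N : nat) (r : 'I_N -> V).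
Let xr (jk : 'I_N * 'I_p) : V := (x ^+ jk.2)%g (r jk.1).
Hypotheses (xrI : injective xr) (xrP : forall v, (x v != v) = (v \in codom xr)).

Lemma big_moved (R : nmodType) (F : V -> R) :
  \sum_(v | x v != v) F v = \sum_j \sum_(k < p) F ((x ^+ k)%g (r j)).
Proof.
rewrite pair_bigA /= (eq_bigl (mem (xr @: setT))) => [|v].
  rewrite big_imset /=; last by move=> u v _ _; apply: xrI.
  by apply: eq_bigl => u; rewrite inE.
rewrite xrP; apply/codomP/imsetP => [[u ->]|[u _ ->]]; last by exists u.
by exists u.
Qed.

Section Twist.

Variables (R : comNzRingType) (z : R).
Hypothesis zp : z ^+ p = 1.

(** The function supported on the orbit of r j that takes the value z ^ k at
    x ^ k (r j).  When z ^ p = 1 it satisfies h (x v) = z * h v; for z = 1 it is the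
    indicator function of the orbit. *)
Definition twist (j : 'I_N) (v : V) : R :=
  \sum_(k < p) (v == (x ^+ k)%g (r j))%:R * z ^+ k.

Lemma twist_shift j v : twist j (x v) = z * twist j v.
Proof.
rewrite /twist; case: p zp ox => [|n] zn on; first by rewrite !big_ord0 mulr0.
(* Cyclic shift of the exponent; z ^ p = 1 absorbs the wrap-around. *)
rewrite (reindex_inj (@ordS_inj n.+1)) mulr_sumr.
apply: eq_bigr => k _ /=.
by rewrite (permX_mod on) expgSr permM (inj_eq perm_inj) expr_mod // exprS mulrCA.
Qed.

Lemma twist_orbit i (k : 'I_p) j :
  twist j ((x ^+ k)%g (r i)) = (i == j)%:R * z ^+ k.
Proof.
rewrite /twist (eq_bigr (fun l : 'I_p => ((i, k) == (j, l))%:R * z ^+ l)).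
  under eq_bigr => l _ do rewrite xpair_eqE.
  rewrite (bigD1 k) //= eqxx andbT big1 ?addr0 // => l /negPf l_k.
  by rewrite (eq_sym k) l_k andbF mul0r.
by move=> l _; rewrite -(inj_eq xrI).
Qed.

Lemma twist_rep i j : twist j (r i) = (i == j)%:R.
Proof.
have := twist_orbit i (Ordinal (prime_gt0 p_pr)) j.
by rewrite /= perm1 expr0 mulr1.
Qed.

Lemma twist_fixed j v : x v = v -> twist j v = 0.
Proof.
move=> xv; apply: big1 => k _; case: eqP => [vE|_]; last by rewrite mul0r.
have : x v != v by rewrite xrP; apply/codomP; exists (j, k).
by rewrite xv eqxx.
Qed.

(** With [twist_rep], this makes the [twist j] a basis of the z-eigenfunctions
    of x on the moved points. *)
Lemma twist_span (h : V -> R) : (forall v, h (x v) = z * h v) ->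
  forall v, x v != v -> h v = \sum_j h (r j) * twist j v.
Proof.
move=> hx v; rewrite xrP => /codomP[[i k] ->]; rewrite /xr /=.
have hX m u : h ((x ^+ m)%g u) = z ^+ m * h u.
  by elim: m => [|m IHm]; rewrite ?perm1 ?mul1r // expgSr permM hx IHm exprS mulrA.
rewrite hX (bigD1 i) //= twist_orbit eqxx mul1r mulrC big1 ?addr0 // => j.
by rewrite eq_sym => /negPf i_j; rewrite twist_orbit i_j mul0r mulr0.
Qed.

End Twist.

Variable D : V -> V -> int.
Hypothesis Dx : forall u v, D (x u) (x v) = D u v.
Variables (a b : int).
Hypothesis D2 : forall u v,
  \sum_w D u w * D w v = (a + b) * D u v - a * b * (u == v)%:R.

Section Action.

Variable R : comNzRingType.

(** Functions rather than vectors, since V has no preferred enumeration. *)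
Definition kernel_apply (h : V -> R) (u : V) : R := \sum_v (D u v)%:~R * h v.

Lemma kernel_applyX (z : R) h : (forall v, h (x v) = z * h v) ->
  forall v, kernel_apply h (x v) = z * kernel_apply h v.
Proof.
move=> hx v; rewrite /kernel_apply (reindex_inj (@perm_inj _ x)) mulr_sumr.
by apply: eq_bigr => w _; rewrite Dx hx mulrCA.
Qed.

Lemma eq_kernel_apply h1 h2 u : h1 =1 h2 -> kernel_apply h1 u = kernel_apply h2 u.
Proof. by move=> h12; apply: eq_bigr => v _; rewrite h12. Qed.

Lemma kernel_apply2 h u :
  kernel_apply (kernel_apply h) u = (a + b)%:~R * kernel_apply h u - (a * b)%:~R * h u.
Proof.
rewrite /kernel_apply; under eq_bigr => w _ do rewrite mulr_sumr.
rewrite exchange_big /=.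
under eq_bigr => v _.
  under eq_bigr => w _ do rewrite mulrA -intrM.
  rewrite -mulr_suml -rmorph_sum /= D2 intrB mulrBl.
  rewrite (intrM _ (a + b)) (intrM _ (a * b)) -mulrA; over.
rewrite sumrB -mulr_sumr; congr (_ - _).
rewrite (bigD1 u) //= eqxx mulr1 big1 ?addr0 // => v.
by rewrite eq_sym => /negPf u_v; rewrite u_v mulr0 mul0r.
Qed.

(** If D preserves the span of the Z j, and evaluation at the s i gives the
    coordinates in this basis, then K is the matrix of D on that span and
    inherits its quadratic equation. *)
Lemma quotient_quadratic n (Z : 'I_n -> V -> R) (s : 'I_n -> V) :
    (forall i j, Z j (s i) = (i == j)%:R) ->
    (forall j v, kernel_apply (Z j) v = \sum_i kernel_apply (Z j) (s i) * Z i v) ->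
  let K := \matrix_(i, j) kernel_apply (Z j) (s i) in
  K *m K = (a + b)%:~R *: K - ((a * b)%:~R)%:M.
Proof.
move=> Zs KZ K; apply/matrixP => i j; rewrite !mxE.
transitivity (kernel_apply (kernel_apply (Z j)) (s i)).
  rewrite (eq_kernel_apply _ (KZ j)) {2}/kernel_apply.
  under [RHS]eq_bigr => v _ do rewrite mulr_sumr.
  rewrite exchange_big /=; apply: eq_bigr => l _; rewrite !mxE mulrC mulr_sumr.
  by apply: eq_bigr => v _; rewrite mulrCA.
by rewrite kernel_apply2 Zs mulr_natr.
Qed.

Lemma kernel_apply_twist (z : R) j u :
  kernel_apply (twist z j) u = \sum_(k < p) (D u ((x ^+ k)%g (r j)))%:~R * z ^+ k.
Proof.
rewrite /kernel_apply; under eq_bigr => v _ do rewrite mulr_sumr.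
rewrite exchange_big /=; apply: eq_bigr => k _.
rewrite (bigD1 ((x ^+ k)%g (r j))) //= eqxx mul1r big1 ?addr0 // => v /negPf vN.
by rewrite vN mul0r mulr0.
Qed.

End Action.

(** The matrix of D on the z-eigenfunctions of x, with z an indeterminate:
    specializing at a p-th root of unity in any ring gives the matrix for that
    root, in particular for the root 1 over the field with p elements. *)
Definition twisted_quotient : 'M[{poly int}]_N :=
  \matrix_(i, j) \sum_(k < p) D (r i) ((x ^+ k)%g (r j)) *: 'X^k.

Lemma int_eval_twisted_quotient (R : comNzRingType) (z : R) :
  map_mx (int_eval z) twisted_quotient = \matrix_(i, j) kernel_apply (twist z j) (r i).
Proof.
apply/matrixP => i j; rewrite !mxE kernel_apply_twist.
by rewrite (int_eval_sum _ _ (fun k => D (r i) ((x ^+ k)%g (r j)))).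
Qed.

Definition orbit_trace (k : nat) : int := \sum_i D (r i) ((x ^+ k)%g (r i)).

(** At a primitive p-th root of unity z the quadratic equation holds, which fixes
    the characteristic polynomial; congruence of z and 1 transports it to
    characteristic p.  The trace at z is the integer a f + b g; as
    1, z, ..., z^(p - 2) are independent over the rationals, the coefficients
    [orbit_trace k] of the positive powers of z must all be equal. *)
Lemma twisted_quotient_char_poly :
    (a - b)%:~R != 0 :> 'F_p ->
  exists f g : nat, [/\ (f + g)%N = N,
    char_poly (map_mx (int_eval (1 : 'F_p)) twisted_quotient) =
      ('X - a%:~R%:P) ^+ f * ('X - b%:~R%:P) ^+ g &
    exists t, (forall k, (0 < k < p)%N -> orbit_trace k = t) /\
              orbit_trace 0 = t + a *+ f + b *+ g].
Proof.
move=> ab; have p_gt0 := prime_gt0 p_pr.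
have [z zP] := C_prim_root_exists p_gt0.
have zp := prim_expr_order zP.
have abC : a%:~R != b%:~R :> algC.
  by rewrite (inj_eq intr_inj); apply: contraNneq ab => ->; rewrite subrr.
have quad : let K := map_mx (int_eval z) twisted_quotient in
    K *m K = (a%:~R + b%:~R) *: K - (a%:~R * b%:~R)%:M.
  rewrite /= int_eval_twisted_quotient -intrD -intrM; apply: quotient_quadratic.
    by move=> i j; apply: twist_rep.
  move=> j v; have [xv|xv] := eqVneq (x v) v; last first.
    by apply: twist_span xv; apply: kernel_applyX => w; apply: (twist_shift zp).
  rewrite big1 => [|i _]; last by rewrite twist_fixed ?mulr0.
  (* At a fixed point, h = z * h forces h = 0. *)
  have z1 : 1 - z != 0.
    rewrite subr_eq0 eq_sym; apply/eqP => z1.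
    by have := prim_order_dvd zP 1; rewrite z1 expr1n eqxx gtnNdvd ?prime_gt1.
  apply: (mulfI z1); rewrite mulr0 mulrBl mul1r.
  by rewrite -kernel_applyX ?xv ?subrr // => w; apply: (twist_shift zp).
have [f [g [fg cE tE]]] := char_poly_quadratic abC quad.
exists f, g; split=> //.
  pose Q : {poly {poly int}} := ('X - a%:P%:P) ^+ f * ('X - b%:P%:P) ^+ g.
  have QE (R : comNzRingType) (y : R) :
      map_poly (int_eval y) Q = ('X - a%:~R%:P) ^+ f * ('X - b%:~R%:P) ^+ g.
    rewrite rmorphM !rmorphXn /= !rmorphB /= map_polyX !map_polyC /=.
    by rewrite !int_evalC.
  rewrite -map_char_poly -(QE _ (1 : 'F_p)); apply/eqP; rewrite -subr_eq0 -rmorphB /=.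
  apply/eqP/polyP => i; rewrite coef0 coef_map /=.
  apply: (int_eval_prim_root p_pr zP).
  by rewrite -coef_map rmorphB /= map_char_poly cE QE subrr coef0.
pose c : int := a *+ f + b *+ g.
pose q : {poly int} := \sum_(k < p) orbit_trace k *: 'X^k - c%:P.
have trE : int_eval z (\sum_(k < p) orbit_trace k *: 'X^k) = c%:~R.
  rewrite /c rmorphD !rmorphMn /= -tE.
  rewrite int_eval_sum /mxtrace.
  under [RHS]eq_bigr => i _ do
    rewrite !mxE (int_eval_sum _ _ (fun k => D (r i) ((x ^+ k)%g (r i)))).
  rewrite exchange_big /=; apply: eq_bigr => k _.
  by rewrite rmorph_sum mulr_suml.
have qz : root (map_poly intr q) z.
  apply/eqP; rewrite -[LHS]/(int_eval z q) rmorphB /= trE.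
  by rewrite int_evalC subrr.
have [s qE] := prim_root_prime_dvd p_pr zP qz.
have PhiE : \sum_(i < p) 'X^i = \poly_(i < p) 1 :> {poly int}.
  by rewrite poly_def; apply: eq_bigr => i _; rewrite scale1r.
have szPhi : size (\sum_(i < p) 'X^i : {poly int}) = p.
  by rewrite PhiE size_poly_eq ?oner_eq0.
have qkE k : (k < p)%N -> q`_k = orbit_trace k - c *+ (k == 0)%N.
  by move=> kp; rewrite coefB -poly_def coef_poly kp coefC; case: eqP.
have szq : (size q <= p)%N.
  rewrite (leq_trans (size_polyD _ _)) // geq_max -poly_def size_poly.
  by rewrite size_polyN (leq_trans (size_polyC_leq1 _)).
(* The degree of q is at most that of 1 + X + ... + X^(p - 1), so the quotient
   is a constant. *)
have [t sE] : exists t, s = t%:P.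
  exists s`_0; apply: size1_polyC; have [->|s_neq0] := eqVneq s 0.
    by rewrite size_poly0.
  have Phi_neq0 : \sum_(i < p) 'X^i != 0 :> {poly int}.
    by rewrite -size_poly_eq0 szPhi -lt0n.
  move: szq; rewrite qE size_mul // szPhi; case: p p_gt0 => // n _.
  by rewrite addnS /= -add1n leq_add2r.
have qk k : (k < p)%N -> q`_k = t.
  by move=> kp; rewrite qE sE PhiE coefCM coef_poly kp mulr1.
exists t; split=> [k /andP[k_gt0 kp]|].
  by rewrite -(qk k) // qkE // (gtn_eqF k_gt0) subr0.
by rewrite -addrA -/c -(qk 0%N) // qkE // eqxx subrK.
Qed.

Let F := [set v | x v == v].

Definition orbit_rep (l : 'I_(#|F| + N)) : V :=
  match split l with inl i => enum_val i | inr j => r j end.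

Definition orbit_indicator (l : 'I_(#|F| + N)) (v : V) : int :=
  match split l with inl i => (v == enum_val i)%:R | inr j => twist 1 j v end.

(** The matrix of D on x-invariant functions, in the basis of indicators of the
    orbits, the fixed points coming first. *)
Definition orbit_quotient : 'M[int]_(#|F| + N) :=
  \matrix_(i, j) kernel_apply (orbit_indicator j) (orbit_rep i).

Definition fixed_mx : 'M[int]_#|F| := \matrix_(i, j) D (enum_val i) (enum_val j).

Lemma fixed_enum_val (i : 'I_#|F|) : x (enum_val i) = enum_val i.
Proof. by have := enum_valP i; rewrite inE => /eqP. Qed.

Lemma moved_rep j : x (r j) != r j.
Proof.
rewrite xrP; apply/codomP; exists (j, Ordinal (prime_gt0 p_pr)).
by rewrite /xr /= perm1.
Qed.

Lemma orbit_indicator_rep i j : orbit_indicator j (orbit_rep i) = (i == j)%:R.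
Proof.
rewrite /orbit_indicator /orbit_rep -(inj_eq (can_inj (@splitK _ _)) i).
case: (split i) => [i'|i']; case: (split j) => [j'|j'].
- by rewrite (inj_eq enum_val_inj).
- by rewrite twist_fixed // fixed_enum_val.
- case: (r i' =P enum_val j') => // rE.
  by have := moved_rep i'; rewrite rE fixed_enum_val eqxx.
- by rewrite twist_rep.
Qed.

Lemma orbit_indicator_shift j v : orbit_indicator j (x v) = orbit_indicator j v.
Proof.
rewrite /orbit_indicator; case: (split j) => j'.
  by rewrite -{1}(fixed_enum_val j') (inj_eq perm_inj).
by rewrite twist_shift ?expr1n ?mul1r.
Qed.

Lemma orbit_indicator_span (h : V -> int) : (forall v, h (x v) = h v) ->
  forall v, h v = \sum_i h (orbit_rep i) * orbit_indicator i v.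
Proof.
move=> hx v; rewrite big_split_ord /=.
have lE (i : 'I_#|F|) : h (orbit_rep (lshift N i)) * orbit_indicator (lshift N i) v =
    h (enum_val i) * (v == enum_val i)%:R.
  by rewrite /orbit_rep /orbit_indicator split_lshift.
have rE (j : 'I_N) : h (orbit_rep (rshift #|F| j)) * orbit_indicator (rshift #|F| j) v =
    h (r j) * twist 1 j v.
  by rewrite /orbit_rep /orbit_indicator split_rshift.
rewrite (eq_bigr _ (fun i _ => lE i)) (eq_bigr _ (fun j _ => rE j)).
have [xv|xv] := eqVneq (x v) v; last first.
  rewrite big1 ?add0r => [|i _]; last first.
    by case: (v =P enum_val i) xv => [->|]; rewrite ?mulr0 // fixed_enum_val eqxx.
  by apply: twist_span xv => w; rewrite mul1r.
have vF : v \in F by rewrite inE xv.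
rewrite addrC big1 ?add0r => [|j _]; last by rewrite twist_fixed ?mulr0.
rewrite (bigD1 (enum_rank_in vF v)) //= enum_rankK_in // eqxx mulr1.
rewrite big1 ?addr0 // => i iN; case: eqP => [vE|]; rewrite ?mulr0 //.
by case/eqP: iN; apply: enum_val_inj; rewrite enum_rankK_in.
Qed.

Lemma orbit_quotient_quadratic :
  orbit_quotient *m orbit_quotient = (a + b) *: orbit_quotient - (a * b)%:M.
Proof.
rewrite -[a + b]intz -[a * b]intz; apply: quotient_quadratic orbit_indicator_rep _ => j.
apply: orbit_indicator_span => v.
by rewrite -[RHS]mul1r; apply: kernel_applyX => w; rewrite mul1r orbit_indicator_shift.
Qed.

Lemma orbit_quotient_char_poly : a != b ->
  exists f g : nat, [/\ (f + g)%N = (#|F| + N)%N,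
    char_poly orbit_quotient = ('X - a%:P) ^+ f * ('X - b%:P) ^+ g
    & \tr orbit_quotient = a *+ f + b *+ g].
Proof.
move=> ab; have abC : a%:~R != b%:~R :> algC by rewrite (inj_eq intr_inj).
have quad : let K := map_mx intr orbit_quotient : 'M[algC]__ in
    K *m K = (a%:~R + b%:~R) *: K - (a%:~R * b%:~R)%:M.
  rewrite /= -map_mxM orbit_quotient_quadratic.
  by rewrite map_mxB map_mxZ map_scalar_mx /= intrD intrM.
have [f [g [fg cE tE]]] := char_poly_quadratic abC quad.
exists f, g; split=> //; last first.
  by apply: (@intr_inj algC); rewrite rmorphD !rmorphMn /= -tE trace_map_mx.
apply: (map_inj_poly (intr_inj : injective (intr : int -> algC)) (rmorph0 _)).
rewrite map_char_poly cE rmorphM !rmorphXn /= !rmorphB /= map_polyX.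
by rewrite !map_polyC.
Qed.

Lemma orbit_quotient_trace :
  \tr orbit_quotient = \sum_(v in F) D v v + \sum_(k < p) orbit_trace k.
Proof.
rewrite /mxtrace big_split_ord /=; congr (_ + _).
  rewrite [RHS]big_enum_val /=; apply: eq_bigr => i _.
  rewrite mxE /kernel_apply /orbit_indicator /orbit_rep split_lshift.
  rewrite (bigD1 (enum_val i)) //= eqxx mulr1.
  rewrite intz big1 ?addr0 // => v /negPf ->; exact: mulr0.
rewrite exchange_big /=; apply: eq_bigr => j _.
rewrite mxE /orbit_indicator /orbit_rep split_rshift kernel_apply_twist.
by apply: eq_bigr => k _; rewrite expr1n mulr1 intz.
Qed.

(** Mod p the upper right block vanishes: D (f, -) is constant along the orbit of
    a moved point when f is fixed, so its sum over the orbit is divisible by p. *)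
Lemma char_poly_orbit_quotient_modp :
  char_poly (map_mx intr orbit_quotient : 'M['F_p]__) =
  char_poly (map_mx intr fixed_mx) *
  char_poly (map_mx (int_eval (1 : 'F_p)) twisted_quotient).
Proof.
set M := map_mx intr orbit_quotient.
rewrite -(char_poly_lblock _ (dlsubmx M)) -{1}[M]submxK.
suff [-> [-> ->]] : ursubmx M = 0 /\ ulsubmx M = map_mx intr fixed_mx /\
    drsubmx M = map_mx (int_eval (1 : 'F_p)) twisted_quotient by [].
split; [|split]; apply/matrixP => i j; rewrite !mxE.
- rewrite /orbit_indicator /orbit_rep split_lshift split_rshift kernel_apply_twist.
  rewrite rmorph_sum /=.
  under eq_bigr => k _.
    rewrite expr1n mulr1 intz.
    have -> : D (enum_val i) ((x ^+ k)%g (r j)) = D (enum_val i) (r j).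
      elim: {k}(k : nat) => [|k IHk]; first by rewrite perm1.
      by rewrite expgSr permM -(fixed_enum_val i) Dx fixed_enum_val.
    over.
  by rewrite sumr_const card_ord -mulr_natr (pchar_Fp_0 p_pr) mulr0.
- rewrite /orbit_indicator /orbit_rep !split_lshift /kernel_apply.
  rewrite (bigD1 (enum_val j)) //= eqxx mulr1.
  by rewrite intz big1 ?addr0 // => v /negPf ->; rewrite mulr0.
- rewrite /orbit_indicator /orbit_rep !split_rshift kernel_apply_twist rmorph_sum /=.
  rewrite (int_eval_sum _ _ (fun k => D (r i) ((x ^+ k)%g (r j)))).
  by apply: eq_bigr => k _; rewrite !expr1n !mulr1 intz.
Qed.

(** Comparing the two characteristic polynomials mod p, the multiplicities on the
    invariant functions exceed those on the z-eigenfunctions by exactly the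
    multiplicities on the fixed points.  Subtracting the two trace identities
    leaves the contribution of the fixed points plus p times the common value of
    [orbit_trace], which is the trace of D x ^ k. *)
Lemma trace_formula_reps :
    (a - b)%:~R != 0 :> 'F_p ->
  exists al be : nat, [/\ (al + be)%N = #|F|,
    char_poly (map_mx intr fixed_mx : 'M['F_p]__) =
      ('X - a%:~R%:P) ^+ al * ('X - b%:~R%:P) ^+ be &
    forall k, coprime p k -> \sum_v D v ((x ^+ k)%g v) = a *+ al + b *+ be].
Proof.
move=> abp; have ab : a != b by apply: contraNneq abp => ->; rewrite subrr.
have abF : b%:~R != a%:~R :> 'F_p by rewrite eq_sym -subr_eq0 -intrB.
have [f [g [fgE cK [t [tk t0]]]]] := twisted_quotient_char_poly abp.
have [f1 [g1 [fg1E cB tB]]] := orbit_quotient_char_poly ab.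
pose P : {poly 'F_p} := char_poly (map_mx intr fixed_mx).
pose Xa : {poly 'F_p} := 'X - a%:~R%:P; pose Xb : {poly 'F_p} := 'X - b%:~R%:P.
have PE : Xa ^+ f1 * Xb ^+ g1 = P * (Xa ^+ f * Xb ^+ g).
  rewrite -cK -char_poly_orbit_quotient_modp -map_char_poly cB rmorphM !rmorphXn /=.
  by rewrite !rmorphB /= map_polyX !map_polyC.
have P0 : P != 0 by rewrite monic_neq0 ?char_poly_monic.
have Xa0 m : Xa ^+ m != 0 by rewrite expf_neq0 ?polyXsubC_eq0.
have Xb0 m : Xb ^+ m != 0 by rewrite expf_neq0 ?polyXsubC_eq0.
have f1E : f1 = (mup a%:~R P + f)%N.
  have := congr1 (mup a%:~R) PE; rewrite !mupM ?mulf_neq0 // !mup_XsubCX.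
  by rewrite eqxx (negPf abF) !addn0.
have g1E : g1 = (mup b%:~R P + g)%N.
  have := congr1 (mup b%:~R) PE; rewrite !mupM ?mulf_neq0 // !mup_XsubCX.
  by rewrite eqxx (eq_sym a%:~R) (negPf abF) !add0n.
exists (mup a%:~R P), (mup b%:~R P); split.
- by move: fg1E; rewrite f1E g1E addnACA fgE => /addIn.
- apply: (mulIf (mulf_neq0 (Xa0 f) (Xb0 g))); rewrite -/P -PE f1E g1E.
  by rewrite !exprD mulrACA.
move=> k kp; rewrite (bigID (fun v => x v == v)) /= big_moved.
have kE v : (x ^+ k)%g v = (x ^+ (k %% p))%g v by rewrite permX_mod.
have k1p : (0 < k %% p < p)%N.
  apply/andP; split; last by rewrite ltn_mod prime_gt0.
  rewrite lt0n; by apply: contraL kp => k0; rewrite prime_coprime // negbK /dvdn.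
have -> : \sum_j \sum_(l < p) D ((x ^+ l)%g (r j)) ((x ^+ k)%g ((x ^+ l)%g (r j)))
    = t *+ p.
  rewrite exchange_big /= -[p in RHS]card_ord -sumr_const; apply: eq_bigr => l _.
  rewrite -(tk _ k1p); apply: eq_bigr => j _.
  have DX m u v : D ((x ^+ m)%g u) ((x ^+ m)%g v) = D u v.
    by elim: m => [|m IHm]; rewrite ?perm1 // expgSr !permM Dx.
  by rewrite kE -!permM -expgD addnC expgD !permM DX.
have -> : \sum_(v | x v == v) D v ((x ^+ k)%g v) = \sum_(v in F) D v v.
  apply: eq_big => [v|v /eqP xv]; first by rewrite inE.
  by rewrite permX_fixed.
have sT : \sum_(l < p) orbit_trace l = t *+ p + a *+ f + b *+ g.
  have p_gt0 := prime_gt0 p_pr.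
  have -> : \sum_(l < p) orbit_trace l =
      \sum_(l < p) (t + (l == 0 :> nat)%:R * (a *+ f + b *+ g)).
    apply: eq_bigr => l _; case: posnP => [->|l_gt0].
      by rewrite t0 mul1r addrA.
    by rewrite tk ?l_gt0 ?ltn_ord // mul0r addr0.
  rewrite big_split /= sumr_const card_ord -addrA; congr (_ + _).
  rewrite (bigD1 (Ordinal p_gt0)) //= mul1r big1 ?addr0 // => l.
  by rewrite -val_eqE /= => /negPf ->; rewrite mul0r.
move: tB; rewrite orbit_quotient_trace sT f1E g1E !mulrnDr => tB.
by apply: (addIr (a *+ f + b *+ g)); rewrite [RHS]addrACA -tB !addrA.
Qed.

End Kernel.

(** The trace of D x ^ k is congruent mod p to the trace of D over the fixed
    points for trivial reasons; lifting the multiplicities al and be of the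
    eigenvalues mod p to characteristic 0 gives its exact value. *)
Lemma trace_formula (V : finType) (x : {perm V}) (p : nat) (D : V -> V -> int)
    (a b : int) :
    prime p -> #[x]%g = p -> (forall u v, D (x u) (x v) = D u v) ->
    (forall u v, \sum_w D u w * D w v = (a + b) * D u v - a * b * (u == v)%:R) ->
    (a - b)%:~R != 0 :> 'F_p ->
  exists al be : nat, [/\ (al + be)%N = #|[set v | x v == v]|,
    char_poly (map_mx intr (fixed_mx x D) : 'M['F_p]__) =
      ('X - a%:~R%:P) ^+ al * ('X - b%:~R%:P) ^+ be &
    forall k, coprime p k -> \sum_v D v ((x ^+ k)%g v) = a *+ al + b *+ be].
Proof.
move=> p_pr ox Dx D2 ab; have [N [r [rI rP]]] := orbit_representatives p_pr ox.
exact: (trace_formula_reps p_pr ox rI rP Dx D2 ab).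
Qed.

Local Close Scope ring_scope.

(** * Moore graphs *)

Section Graphs.

Variable G : sgraph.

Definition neighbours (u : G) : {set G} := [set w | adj u w].
Definition common (u v : G) : nat := #|[set w | adj u w && adj w v]|.

Lemma walk0 (u v : G) : walk 0 u v = (u == v).
Proof.
apply/existsP/eqP => [[w]|->]; first by rewrite tuple0 /= => /eqP.
by exists [tuple]; rewrite /= eqxx.
Qed.

Lemma walk1 (u v : G) : walk 1 u v = adj u v.
Proof.
apply/existsP/idP => [[w]|uv]; last by exists [tuple v]; rewrite /= uv eqxx.
by case/tupleP: w => w t; rewrite tuple0 /= andbT => /andP[uw /eqP <-].
Qed.

Lemma walk2P (u v : G) : walk 2 u v -> exists w, adj u w && adj w v.
Proof.
case/existsP => w; case/tupleP: w => w t; case/tupleP: t => w' t.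
by rewrite tuple0 /= andbT => /andP[uw /eqP <-]; exists w.
Qed.

Lemma dist_eq0 (u v : G) : 0 < #|G| -> (dist u v == 0) = (u == v).
Proof.
rewrite /dist; case: #|G| => // n _ /=.
by rewrite walk0; case: (u == v).
Qed.

Lemma dist_eq1 (u v : G) : 1 < #|G| -> (dist u v == 1) = adj u v.
Proof.
rewrite /dist; case: #|G| => [|[|n]] // _ /=; rewrite walk0 walk1.
case: (u =P v) => [->|_]; first by rewrite adj_irrefl.
by case: (adj u v).
Qed.

Lemma diameter2_common_gt0 (u v : G) : 2 < #|G| -> diameter G = 2 -> u != v ->
  ~~ adj u v -> 0 < common u v.
Proof.
move=> G_gt2 diam uv auv; have : dist u v <= 2.
  by rewrite -diam (leq_trans _ (leq_bigmax u)) // (leq_bigmax v).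
rewrite /dist; case: #|G| G_gt2 => [|[|[|n]]] // _ /=.
rewrite walk0 walk1 (negPf uv) (negPf auv).
case: ifP => // /walk2P[w uwv] _.
by apply/card_gt0P; exists w; rewrite inE.
Qed.

Variable k : nat.
Hypotheses (k_gt1 : 1 < k) (moore : moore_diameter2 G k).

Lemma moore_card_gt2 : 2 < #|G|.
Proof. by have [_ _ _ ->] := moore; case: k k_gt1 => [|[|n]]. Qed.

Lemma common_refl u : common u u = k.
Proof.
have [reg _ _ _] := moore; rewrite -[RHS](reg u); apply: eq_card => w.
by rewrite !inE (adj_sym w) andbb.
Qed.

Lemma sum_common u : \sum_v common u v = k * k.
Proof.
have [reg _ _ _] := moore.
have -> : \sum_v common u v = \sum_v \sum_(w | adj u w) adj w v.
  apply: eq_bigr => v _; rewrite /common -sum1_card big_mkcond [RHS]big_mkcond.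
  by apply: eq_bigr => w _; rewrite inE; case: (adj u w); case: (adj w v).
rewrite exchange_big (eq_bigr (fun _ => k)) /= => [|w _].
  by rewrite sum_nat_const -{2}(reg u) cardsE.
rewrite -[RHS](reg w) -sum1_card [RHS]big_mkcond.
by apply: eq_bigr => v _; rewrite inE; case: (adj w v).
Qed.

(** Every term in the sum of adj u w + common u w over w different from u is at
    least 1, because the diameter is 2.  Counting walks of length 2 shows that
    this sum is k ^ 2, the number of terms, so every term is 1. *)
Lemma moore_common u v : u != v -> adj u v + common u v = 1.
Proof.
have [reg _ diam cG] := moore.
have leq1 w : w != u -> 1 <= adj u w + common u w ?= iff (adj u w + common u w == 1).
  move=> wu; split; last by rewrite eq_sym.
  case auw : (adj u w) => //; rewrite diameter2_common_gt0 ?auw ?moore_card_gt2 //.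
  by rewrite eq_sym.
rewrite eq_sym => vu; have [_] := leqif_sum leq1.
have -> : \sum_(w | w != u) 1 = k ^ 2.
  have := cG; rewrite -sum1_card (bigD1 u) //= => /eqP.
  by rewrite eqn_add2l => /eqP.
have -> : \sum_(w | w != u) (adj u w + common u w) = k ^ 2.
  rewrite big_split /=.
  have := sum_common u; rewrite (bigD1 u) //= common_refl.
  suff -> : \sum_(w | w != u) adj u w = k by rewrite mulnn.
  rewrite -[RHS](reg u) -sum1_card [RHS]big_mkcond [RHS](bigD1 u) //= inE adj_irrefl.
  by apply: eq_bigr => w _; rewrite inE; case: (adj u w).
by rewrite eqxx => /esym/forallP/(_ v)/implyP/(_ vu)/eqP.
Qed.

End Graphs.

(** * Subgraphs closed under common neighbours *)

(** The fixed points of an automorphism form such a set F: the image of a common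
    neighbour of two fixed points is again a common neighbour. *)
Section ClosedSets.

Variable G : sgraph.
Hypothesis moore : moore_diameter2 G 57.
Variable F : {set G}.
Hypothesis F_closed : forall u v w, u \in F -> v \in F -> u != v ->
  adj u w -> adj w v -> w \in F.

Let regG (u : G) : #|neighbours u| = 57.
Proof. by have [reg _ _ _] := moore; apply: reg. Qed.
Let cardG : #|G| = 3250. Proof. by have [_ _ _ ->] := moore. Qed.

Lemma common_neighbour_unique (u v w w' : G) : u != v ->
  adj u w -> adj w v -> adj u w' -> adj w' v -> w = w'.
Proof.
move=> uv uw wv uw' w'v.
have : #|[set y | adj u y && adj y v]| <= 1.
  by rewrite -(moore_common (isT : 1 < 57) moore uv) leq_addl.
move/card_le1P => /(_ w); rewrite inE uw wv => /(_ isT w').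
by rewrite !inE uw' w'v => /esym/eqP.
Qed.

Lemma triangle_free (u v w : G) : adj u v -> adj u w -> adj v w = false.
Proof.
move=> uv uw; apply/negP => vw.
have neq_uv : u != v by apply: contraTneq uv => ->; rewrite adj_irrefl.
have := moore_common (isT : 1 < 57) moore neq_uv; rewrite uv => -[].
by apply/eqP; rewrite -lt0n; apply/card_gt0P; exists w; rewrite inE uw adj_sym.
Qed.

Lemma common_neighbour (u v : G) : u != v -> ~~ adj u v ->
  exists w, adj u w && adj w v.
Proof.
move=> uv auv; have := moore_common (isT : 1 < 57) moore uv.
rewrite (negPf auv) add0n => c1; have : 0 < common u v by rewrite c1.
by case/card_gt0P => w; rewrite inE; exists w.
Qed.

Definition degree_in (u : G) : nat := #|neighbours u :&: F|.

(** Send a neighbour y of u to the common neighbour of y and v, or to y itself if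
    y is adjacent to v.  Two preimages of the same vertex would give a triangle
    or a 4-cycle through u. *)
Lemma leq_degree_in_nonadj u v : u \in F -> v \in F -> u != v -> ~~ adj u v ->
  degree_in u <= degree_in v.
Proof.
move=> uF vF uv auv.
pose phi y := odflt u [pick z in neighbours v :&: F | (z == y) || adj y z].
have phiP y : y \in neighbours u :&: F ->
    phi y \in neighbours v :&: F /\ ((phi y == y) || adj y (phi y)).
  move=> yP; rewrite /phi; case: pickP => [z /andP[zv zy] //|] /=.
  move: yP; rewrite !inE => /andP[uy yF].
  have [yv|yv] := boolP (adj y v).
    by move/(_ y); rewrite !inE eqxx adj_sym yv yF.
  have neq_yv : y != v by apply: contraNneq auv => <-.
  have [z /andP[yz zv]] := common_neighbour neq_yv yv.
  move/(_ z); rewrite !inE yz orbT adj_sym zv.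
  by rewrite (F_closed yF vF neq_yv yz zv).
have phi_inj : {in neighbours u :&: F &, injective phi}.
  move=> y1 y2 y1P y2P; have [] := phiP _ y1P; have [] := phiP _ y2P.
  move: y1P y2P; rewrite !inE => /andP[uy1 _] /andP[uy2 _].
  move: (phi y1) (phi y2) => z z' /andP[_ _] z'y2 /andP[vz _] zy1 zz'.
  rewrite -{z'}zz' in z'y2.
  have neq_uz : u != z by apply: contraNneq auv => ->; rewrite adj_sym.
  case/orP: zy1 => [/eqP zy1|y1z]; case/orP: z'y2 => [/eqP zy2|y2z].
  - by rewrite -zy1.
  - by move: (triangle_free uy2 uy1); rewrite -zy1 y2z.
  - by move: (triangle_free uy1 uy2); rewrite -zy2 y1z.
  - exact: common_neighbour_unique neq_uz uy1 y1z uy2 y2z.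
rewrite /degree_in -(card_in_imset phi_inj) subset_leq_card //.
by apply/subsetP => _ /imsetP[y yP ->]; case: (phiP _ yP).
Qed.

Lemma degree_in_nonadj u v : u \in F -> v \in F -> u != v -> ~~ adj u v ->
  degree_in u = degree_in v.
Proof.
move=> uF vF uv auv; apply/eqP; rewrite eqn_leq !leq_degree_in_nonadj //.
  by rewrite eq_sym.
by rewrite adj_sym.
Qed.

(** Count the walks of length 2 inside F that start at u: those returning to u
    number deg u, and those ending at v different from u number
    1 - adj u v, because F contains the common neighbour. *)
Lemma card_closed u : u \in F ->
  #|F| = (\sum_(w in neighbours u :&: F) degree_in w).+1.
Proof.
move=> uF.
have -> : \sum_(w in neighbours u :&: F) degree_in w =
    \sum_(v in F) #|[set w in neighbours u :&: F | adj w v]|.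
  transitivity (\sum_(w in neighbours u :&: F) \sum_(v in F) (adj w v : nat)).
    apply: eq_bigr => w _; rewrite /degree_in -sum1_card big_mkcond [RHS]big_mkcond.
    by apply: eq_bigr => v _; rewrite !inE; case: (adj w v); case: (v \in F).
  rewrite exchange_big /=; apply: eq_bigr => v _.
  rewrite -sum1_card big_mkcond [RHS]big_mkcond; apply: eq_bigr => w _.
  by rewrite !inE; case: (adj u w); case: (w \in F); case: (adj w v).
have degE : \sum_(v in F | v != u) adj u v = degree_in u.
  rewrite /degree_in -sum1_card big_mkcond [RHS]big_mkcond; apply: eq_bigr => v _.
  rewrite !inE; case: eqP => [->|_]; first by rewrite adj_irrefl andbF.
  by rewrite andbT; case: (adj u v); case: (v \in F).
rewrite -sum1_card (bigD1 u uF) /= (bigD1 u uF) /= add1n; congr _.+1.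
have -> : #|[set w in neighbours u :&: F | adj w u]| = degree_in u.
  by apply: eq_card => w; rewrite !inE (adj_sym w); case: (adj u w); rewrite ?andbT.
rewrite -degE -big_split /=; apply: eq_bigr => v /andP[vF vu].
rewrite eq_sym in vu; rewrite -(moore_common (isT : 1 < 57) moore vu).
congr (_ + _); apply: eq_card => w; rewrite !inE.
apply: andb_id2r => wv; apply/idP/andP => [uw|[]//]; split=> //.
exact: F_closed uF vF vu uw wv.
Qed.

Definition boundary : {set G} := [set v in ~: F | [exists u in F, adj v u]].

(** A vertex outside F has at most one neighbour in F, since two of them would
    put it in F; so the edges leaving F count the boundary. *)
Lemma card_boundary :
  #|boundary| + \sum_(u in F) degree_in u = 57 * #|F|.
Proof.
have -> : #|boundary| = \sum_(u in F) #|neighbours u :\: F|.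
  transitivity (\sum_(u in F) \sum_(v in ~: F) (adj u v : nat)); last first.
    apply: eq_bigr => u _; rewrite -sum1_card big_mkcond [RHS]big_mkcond.
    by apply: eq_bigr => v _; rewrite !inE; case: (adj u v); case: (v \in F).
  rewrite exchange_big /= -sum1_card big_mkcond [RHS]big_mkcond.
  apply: eq_bigr => v _; rewrite !inE; have [//|vF] /= := boolP (v \in F).
  case: ifP => [/existsP[u /andP[uF vu]]|/negbT/existsPn no]; last first.
    rewrite big1 // => u uF; have := no u; rewrite uF adj_sym.
    by case: (adj u v).
  rewrite (bigD1 u uF) /= (adj_sym u) vu big1 // => w /andP[wF wu].
  case wv: (adj w v) => //; case/negP: vF.
  by apply: (F_closed wF uF wu wv vu).
rewrite -big_split /= mulnC -sum_nat_const; apply: eq_bigr => u _.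
by rewrite addnC cardsID regG.
Qed.

Lemma closed_boundary_le : #|F| + #|boundary| <= 3250.
Proof.
rewrite -cardG -cardsUI -[X in _ + X]/(#|_|).
have -> : F :&: boundary = set0.
  by apply/setP => v; rewrite !inE; case: (v \in F).
by rewrite cards0 addn0 max_card.
Qed.

(** Non-adjacent vertices have equal degrees.  For adjacent u and v, take a
    further neighbour y of u and z of v: there is no edge yz, as it would close a
    4-cycle, so the degrees of u, z, y, v are equal in this order. *)
Lemma closed_regular : (forall u, u \in F -> 1 < degree_in u) ->
  forall u v, u \in F -> v \in F -> degree_in u = degree_in v.
Proof.
move=> deg2 u v uF vF; have [->//|uv] := eqVneq u v.
have [auv|auv] := boolP (adj u v); last exact: degree_in_nonadj.
have other a b : a \in F -> exists y, [/\ y \in F, adj a y & y != b].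
  move=> aF; have := deg2 a aF; rewrite /degree_in (cardsD1 b) => deg.
  have : 0 < #|(neighbours a :&: F) :\ b|.
    by case: (b \in _) deg; rewrite ?add1n ?add0n // => /ltnW.
  by case/card_gt0P => y; rewrite !inE => /and3P[yb ay yF]; exists y.
have [y [yF uy yv]] := other u v uF; have [z [zF vz zu]] := other v u vF.
have avu : adj v u by rewrite adj_sym.
have neq_uz : u != z by rewrite eq_sym.
have neq_vy : v != y by rewrite eq_sym.
have auz : ~~ adj u z by rewrite (triangle_free avu vz).
have avy : ~~ adj v y by rewrite (triangle_free auv uy).
have yz : ~~ adj y z.
  apply: contra neq_vy => yz; apply/eqP.
  exact: (common_neighbour_unique neq_uz auv vz uy yz).
have neq_yz : y != z by apply: contraNneq auz => <-.
rewrite (degree_in_nonadj uF zF neq_uz auz) (degree_in_nonadj vF yF neq_vy avy).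
by rewrite (degree_in_nonadj yF zF neq_yz yz).
Qed.

(** F and its boundary have (1 + d ^ 2)(58 - d) vertices together, and this
    exceeds 3250 for 9 <= d <= 56. *)
Lemma closed_regular_degree d : 
    F != set0 -> (forall u, u \in F -> degree_in u = d) ->
  [/\ #|F| = 1 + d ^ 2, #|boundary| = #|F| * (57 - d) & d <= 8 \/ d = 57].
Proof.
case/set0Pn => u uF degF.
have cF : #|F| = 1 + d ^ 2.
  rewrite (card_closed uF) add1n; congr _.+1.
  rewrite (eq_bigr (fun _ => d)) => [|w]; last by rewrite inE => /andP[_ /degF].
  by rewrite sum_nat_const -/(degree_in u) degF // mulnn.
have d57 : d <= 57 by rewrite -(degF u uF) -(regG u) subset_leq_card ?subsetIl.
have bF : #|boundary| = #|F| * (57 - d).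
  have := card_boundary; rewrite (eq_bigr (fun _ => d)) // sum_nat_const mulnBr.
  by lia.
split=> //; have := closed_boundary_le; rewrite bF cF.
have [d8|d9] := leqP d 8; first by left.
have [d57'|] := ltnP d 57; last by right; lia.
(* On each range the product of the least values of its two factors already
   exceeds 3250. *)
have [d17|d17] := leqP d 17; first by nia.
have [d40|d40] := leqP d 40; first by nia.
have [d50|d50] := leqP d 50; first by nia.
nia.
Qed.

End ClosedSets.

Section Degree5.

Variable G : sgraph.
Hypothesis moore : moore_diameter2 G 57.
Variable F : {set G}.
Hypothesis F_closed : forall u v w, u \in F -> v \in F -> u != v ->
  adj u w -> adj w v -> w \in F.

Local Open Scope ring_scope.

(** Its adjacency matrix satisfies A^2 + A - 4 = J and JA = 5 J, so an eigenvector
    for z gives (z - 5)(z^2 + z - 4) = 0. *)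
Lemma closed_degree5_dvd11 : (forall u, u \in F -> degree_in F u = 5%N) -> (11 %| #|F|)%N.
Proof.
move=> degF.
pose A : 'M[algC]_#|F| := \matrix_(i, j) (adj (enum_val i) (enum_val j))%:R.
apply: (@trace0_dvd11 _ A).
  by apply: big1 => i _; rewrite mxE adj_irrefl.
pose J : 'M[algC]_#|F| := const_mx 1.
have sumF (f : G -> nat) : \sum_(l < #|F|) (f (enum_val l))%:R =
    (\sum_(w in F) f w)%:R :> algC.
  by rewrite natr_sum [RHS]big_enum_val.
have JA : J *m A = 5 *: J.
  apply/matrixP => i j; rewrite !mxE mulr1.
  under eq_bigr => l _ do rewrite !mxE mul1r.
  rewrite (sumF (fun w => adj w (enum_val j))).
  rewrite -(degF _ (enum_valP j)) /degree_in -sum1_card; congr _%:R.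
  rewrite big_mkcond [RHS]big_mkcond; apply: eq_bigr => w _.
  by rewrite !inE (adj_sym w); case: (adj _ w); case: (w \in F).
have AA : A *m A + A = 4%:M + J.
  apply/matrixP => i j; rewrite !mxE.
  under eq_bigr => l _ do rewrite !mxE -natrM.
  rewrite (sumF (fun w => (adj (enum_val i) w * adj w (enum_val j))%N)).
  rewrite -natrD; have iF := enum_valP i; have jF := enum_valP j.
  have [<-|ij] := eqVneq i j.
    have -> : (\sum_(w in F) adj (enum_val i) w * adj w (enum_val i))%N = 5%N.
      rewrite -(degF _ iF) /degree_in -sum1_card big_mkcond [RHS]big_mkcond.
      apply: eq_bigr => w _; rewrite !inE (adj_sym w).
      by case: (adj _ w); case: (w \in F).
    by rewrite adj_irrefl addn0 mulr1n natr1.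
  have eij : enum_val i != enum_val j by rewrite (inj_eq enum_val_inj).
  rewrite -[1 in RHS]/(1%N%:R).
  rewrite -(moore_common (isT : (1 < 57)%N) moore eij) mulr0n add0r addnC.
  congr (_ + _)%N%:R; rewrite /common -sum1_card big_mkcond [RHS]big_mkcond.
  apply: eq_bigr => w _; rewrite inE.
  case iw: (adj _ w); case wj: (adj w _); rewrite ?if_same //.
  by rewrite (F_closed iF jF eij iw wj).
move=> z /eigenvalueP[v vA v_neq0].
have : ((z - 5) * (z ^+ 2 + z - 4)) *: v = 0.
  have vJ : v *m J = (z ^+ 2 + z - 4) *: v.
    have := congr1 (mulmx v) AA; rewrite !mulmxDr mulmxA !vA -scalemxAl vA.
    rewrite mul_mx_scalar scalerA => E.
    rewrite -[LHS](addKr (4 *: v)) -E -scalerDl -scaleNr -scalerDl.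
    by congr (_ *: _); ring.
  have := congr1 (mulmx v) JA; rewrite mulmxA -scalemxAr vJ -scalemxAl vA.
  by rewrite !scalerA => E; rewrite mulrBl scalerBl (mulrC z) E subrr.
by move/eqP; rewrite scaler_eq0 (negPf v_neq0) orbF => /eqP.
Qed.

End Degree5.

(** * Automorphisms of prime order *)

Section MooreAutomorphism.

Variable G : sgraph.
Hypothesis moore : moore_diameter2 G 57.
Variable x : {perm G}.
Hypothesis autx : x \in graph_aut G.
Variable p : nat.
Hypotheses (p_pr : prime p) (ox : #[x]%g = p).

Definition fixv : {set G} := [set v | x v == v].
Definition shifted (k : nat) : {set G} := [set v | adj v ((x ^+ k)%g v)].

Let regG (u : G) : #|neighbours u| = 57.
Proof. by have [reg _ _ _] := moore; apply: reg. Qed.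
Let commonG := moore_common (isT : 1 < 57) moore.
Let cardG : #|G| = 3250. Proof. by have [_ _ _ ->] := moore. Qed.

Lemma aut_adj u v : adj (x u) (x v) = adj u v.
Proof. by move: autx; rewrite inE => /forallP/(_ u)/forallP/(_ v)/eqP. Qed.

Lemma aut_adjX k u v : adj ((x ^+ k)%g u) ((x ^+ k)%g v) = adj u v.
Proof. by elim: k => [|k IHk]; rewrite ?perm1 // expgSr !permM aut_adj. Qed.

Lemma displaced0 : 'a_0 x = #|fixv|.
Proof.
by apply: eq_card => u; rewrite !inE dist_eq0 ?cardG // eq_sym.
Qed.

Lemma displaced1 : 'a_1 x = #|shifted 1|.
Proof. by apply: eq_card => u; rewrite !inE dist_eq1 ?cardG. Qed.

Lemma invariant_fix_mod (S : {set G}) : (forall v, (x v \in S) = (v \in S)) ->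
  #|S| = #|S :&: fixv| %[mod p].
Proof.
move=> xS; have pX : (p.-group <[x]>)%g by rewrite /pgroup -orderE ox pnat_id.
have actsX : [acts <[x]>%g, on S | 'P]%act.
  rewrite cycle_subG !inE /=; apply/subsetP => v vS.
  by rewrite inE /aperm xS.
rewrite (pgroup_fix_mod pX actsX); congr (#|_ :&: _| %% _).
by apply/setP => v; rewrite afix_cycle [RHS]inE; apply/afix1P/eqP.
Qed.

Lemma invariant_moved_dvd (S : {set G}) : (forall v, (x v \in S) = (v \in S)) ->
  [disjoint S & fixv] -> p %| #|S|.
Proof.
move=> /invariant_fix_mod SE; rewrite -setI_eq0 => /eqP SF.
by rewrite /dvdn SE SF cards0 mod0n.
Qed.

Lemma shifted_dvd k : p %| #|shifted k|.
Proof.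
apply: invariant_moved_dvd => [v|].
  by rewrite !inE -permM -expgS expgSr permM aut_adj.
rewrite disjoints_subset; apply/subsetP => v; rewrite !inE.
by apply: contraTN => /eqP xv; rewrite permX_fixed ?adj_irrefl.
Qed.

Local Open Scope ring_scope.

(** 50 A - J, the coefficient 50 = 57 - 7 being what makes the eigenvalue of the
    all-ones vector equal to -400, the value on the eigenspace of A for -8. *)
Definition moore_kernel (u v : G) : int := 50 * (adj u v)%:Z - 1.

Lemma moore_kernel_quadratic u v :
  \sum_w moore_kernel u w * moore_kernel w v =
  (350 + (-400)) * moore_kernel u v - 350 * (-400) * (u == v)%:R.
Proof.
have nbE (w : G) : \sum_v (adj w v)%:Z = 57.
  rewrite -[RHS]/(57%:Z) -(regG w) -sum1_card -natz natr_sum [RHS]big_mkcond.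
  by apply: eq_bigr => y _; rewrite inE; case: (adj w y).
have comE : \sum_w (adj u w)%:Z * (adj w v)%:Z = (common u v)%:Z.
  rewrite /common -sum1_card -natz natr_sum [RHS]big_mkcond.
  by apply: eq_bigr => y _; rewrite inE; case: (adj u y); case: (adj y v).
have -> : \sum_w moore_kernel u w * moore_kernel w v =
    2500 * (common u v)%:Z - 2450.
  transitivity (\sum_w (2500 * ((adj u w)%:Z * (adj w v)%:Z) -
     50 * (adj u w)%:Z - 50 * (adj v w)%:Z + 1)).
    by apply: eq_bigr => w _; rewrite /moore_kernel (adj_sym v); ring.
  rewrite big_split /= !sumrB -!mulr_sumr comE !nbE sumr_const cardT -cardE cardG.
  by rewrite -mulr_natr; ring.
rewrite /moore_kernel; case: eqP => [->|/eqP/commonG cE].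
  by rewrite (common_refl moore) adj_irrefl.
by rewrite mulr0; lia.
Qed.

(** Here p > 5 is what keeps 350 and -400 distinct mod p: their difference is
    2 * 3 * 5 ^ 3. *)
Lemma shifted_trace : (5 < p)%N ->
  exists al be : nat, [/\ (al + be)%N = #|fixv|,
    char_poly (map_mx intr (fixed_mx x moore_kernel) : 'M['F_p]__) =
      ('X - 350%:~R%:P) ^+ al * ('X - (- 400)%:~R%:P) ^+ be &
    forall k, coprime p k -> (#|shifted k| + 8 * #|fixv|)%N = (65 + 15 * al)%N].
Proof.
move=> p_gt5.
have ab : (350 - (-400))%:~R != 0 :> 'F_p.
  have -> : 350 - (-400) = (2 * 3 * (5 * (5 * 5)))%N%:Z by [].
  rewrite -pmulrn -(dvdn_pcharf (pchar_Fp p_pr)).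
  rewrite !Euclid_dvdM // !dvdn_prime2 //.
  by move: p_gt5; case: p => [|[|[|[|[|[|n]]]]]].
have Dx u v : moore_kernel (x u) (x v) = moore_kernel u v.
  by rewrite /moore_kernel aut_adj.
have [al [be [abE cE tE]]] := trace_formula p_pr ox Dx moore_kernel_quadratic ab.
exists al, be; split=> //.
move=> k kp; have := tE _ kp.
have -> : \sum_v moore_kernel v ((x ^+ k)%g v) = 50 * #|shifted k|%:Z - 3250.
  rewrite sumrB -mulr_sumr sumr_const cardT -cardE cardG; congr (50 * _ - _).
  rewrite -sum1_card -natz natr_sum [RHS]big_mkcond.
  by apply: eq_bigr => v _; rewrite inE; case: (adj v _).
rewrite -/fixv in abE; lia.
Qed.

End MooreAutomorphism.

(** * The fixed subgraph *)

Section FixedStructure.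

Variable G : sgraph.
Hypothesis moore : moore_diameter2 G 57.
Variable x : {perm G}.
Hypothesis autx : x \in graph_aut G.
Variable p : nat.
Hypotheses (p_pr : prime p) (ox : #[x]%g = p).

Let F : {set G} := fixv x.
Let cardG : #|G| = 3250. Proof. by have [_ _ _ ->] := moore. Qed.

Lemma fixv_closed u v w : u \in F -> v \in F -> u != v ->
  adj u w -> adj w v -> w \in F.
Proof.
rewrite !inE => /eqP xu /eqP xv uv uw wv; apply/eqP.
apply: (common_neighbour_unique moore uv) => //.
  by rewrite -xu aut_adj.
by rewrite -xv aut_adj.
Qed.

Lemma card_fixv_mod : #|F| = 3250 %[mod p].
Proof.
have := invariant_fix_mod p_pr ox (fun v => etrans (in_setT (x v)) (esym (in_setT v))).
by rewrite setTI cardsT cardG => ->.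
Qed.

Lemma fixv_neq0 : ~~ (p %| 3250) -> F != set0.
Proof.
apply: contraNneq => F0; have := card_fixv_mod.
by rewrite F0 cards0 mod0n /dvdn => <-.
Qed.

Lemma degree_in_fixv_mod u : u \in F -> degree_in F u = 57 %[mod p].
Proof.
rewrite inE => /eqP xu; have [reg _ _ _] := moore.
rewrite /degree_in -invariant_fix_mod ?[#|neighbours u|](reg u) // => v.
by rewrite !inE -{1}xu aut_adj.
Qed.

Lemma fixv_neqT : F != setT.
Proof.
apply: contraTneq p_pr => FT; rewrite -ox.
suff -> : x = 1%g by rewrite order1.
by apply/permP => v; rewrite perm1; apply/eqP; have := in_setT v; rewrite -FT inE.
Qed.

Lemma fixv_regular : F != set0 -> (forall u, u \in F -> 1 < degree_in F u) ->
  exists d, [/\ forall u, u \in F -> degree_in F u = d, #|F| = 1 + d ^ 2,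
    #|boundary F| = #|F| * (57 - d) & [/\ 1 < d, d <= 8 & d = 57 %[mod p]]].
Proof.
move=> F0 deg2; case/set0Pn: (F0) => u uF; exists (degree_in F u).
have degF v : v \in F -> degree_in F v = degree_in F u.
  by move=> vF; apply: (closed_regular moore fixv_closed deg2).
have [cF bF d8] := closed_regular_degree moore fixv_closed F0 degF.
split=> //; split; [exact: deg2 | | exact: degree_in_fixv_mod].
case: d8 => // d57; have /eqP[] := fixv_neqT.
by apply/eqP; rewrite eqEcard subsetT cardsT cardG cF d57.
Qed.

Definition far_from_fixv : {set G} := ~: (F :|: boundary F).

Lemma card_far_from_fixv : #|F| + #|boundary F| + #|far_from_fixv| = 3250.
Proof.
have dis : F :&: boundary F = set0.
  by apply/setP => v; rewrite 2!inE in_set0 !inE; case: (x v == v).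
have := cardsC (F :|: boundary F); rewrite cardG => <-.
by rewrite -(cardsUI F) dis cards0 addn0.
Qed.

(** A fixed vertex adjacent to v is adjacent to x ^ k v as well, which would close
    a triangle. *)
Lemma shifted_far_from_fixv k : shifted x k \subset far_from_fixv.
Proof.
apply/subsetP => v; rewrite inE => vk; rewrite inE in_setU.
have [vF|vF] /= := boolP (v \in F).
  by move: vF vk; rewrite inE => /eqP xv; rewrite permX_fixed // adj_irrefl.
apply/negP; rewrite inE => /andP[_ /existsP[u /andP[uF vu]]].
have := triangle_free moore vu vk.
rewrite -(permX_fixed k (_ : x u = u)); last by apply/eqP; rewrite inE in uF.
by rewrite aut_adjX // adj_sym vu.
Qed.

(** If v is adjacent to x ^ i v and to x ^ j v, then v, x ^ i v, x ^ (i + j) v,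
    x ^ j v is a closed walk of length 4, and there are no 4-cycles. *)
Lemma shifted_disjoint i j : ~~ (p %| i + j) -> ~~ (p %| i - j) -> j <= i ->
  [disjoint shifted x i & shifted x j].
Proof.
move=> pij pimj le_ji; rewrite -setI_eq0; apply/eqP/setP => v; rewrite !inE.
apply/negP => /andP[vi vj].
have xv : x v != v.
  by apply: contraTneq vi => xv; rewrite permX_fixed ?adj_irrefl.
have e1 : (x ^+ i)%g v = (x ^+ j)%g v.
  apply: (@common_neighbour_unique G moore v ((x ^+ (i + j))%g v)) => //.
  - by apply: contra pij => /eqP vE; rewrite (permX_fix_dvd p_pr ox xv).
  - by rewrite addnC expgD permM aut_adjX.
  - by rewrite expgD permM aut_adjX.
case/negP: pimj; apply: (permX_fix_dvd p_pr ox xv).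
apply: (@perm_inj _ (x ^+ j)%g); rewrite -permM -expgD subnK //.
Qed.

(** A fixed vertex u with a single fixed neighbour w: any other fixed vertex has
    a fixed common neighbour with u, which can only be w. *)
Lemma star_center u : u \in F -> degree_in F u = 1 ->
  exists2 w, w \in F & [/\ #|F| = (degree_in F w).+1,
    (forall v, v \in F -> v != w -> adj v w) &
    (forall v, v \in F -> v != w -> degree_in F v = 1)].
Proof.
move=> uF /eqP /cards1P[w NuF].
have : w \in neighbours u :&: F by rewrite NuF set11.
rewrite !inE => /andP[uw wF].
have adjw v : v \in F -> v != w -> adj v w.
  move=> vF vw; have [->//|vu] := eqVneq v u.
  have uv : u != v by rewrite eq_sym.
  have [auv|auv] := boolP (adj u v).
    have : v \in neighbours u :&: F by rewrite !inE auv; rewrite inE in vF.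
    by rewrite NuF inE (negPf vw).
  have [y /andP[uy yv]] := common_neighbour moore uv auv.
  have : y \in neighbours u :&: F by rewrite inE inE uy (fixv_closed uF vF uv uy yv).
  by rewrite NuF inE => /eqP <-; rewrite adj_sym.
have wF' : w \in F by rewrite inE.
exists w => //; split=> //.
  rewrite (card_closed moore fixv_closed uF) NuF big_set1 //.
move=> v vF vw; apply/eqP/cards1P; exists w; apply/setP => y.
rewrite in_setI in_set1 inE; apply/andP/eqP => [[vy yF]|->].
  apply: contraTeq vy => yw.
  have wv : adj w v by rewrite adj_sym adjw.
  by rewrite (triangle_free moore wv) // adj_sym adjw.
by split=> //; apply: adjw.
Qed.

End FixedStructure.

Section Star.

Variable G : sgraph.
Hypothesis moore : moore_diameter2 G 57.
Variable x : {perm G}.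
Let F : {set G} := fixv x.

Local Open Scope ring_scope.

(** Mod 7 the kernel is A - J, whose entries on a star with centre w are -1 when
    both or neither of the indices are w, and 0 otherwise: a matrix of rank at
    most 2.  By Sylvester's identity, 0 = 350 is then a root of its
    characteristic polynomial of multiplicity at least #|F| - 2. *)
Lemma star_multiplicity w al be : w \in F ->
    (forall v, v \in F -> v != w -> adj v w) ->
    char_poly (map_mx intr (fixed_mx x (moore_kernel (G := G))) : 'M['F_7]__) =
      ('X - 350%:~R%:P) ^+ al * ('X - (- 400)%:~R%:P) ^+ be ->
  (#|F| <= al + 2)%N.
Proof.
move=> wF adjw cE.
have F7 (m : nat) : (m%:R == 0 :> 'F_7) = (7 %| m)%N.
  by rewrite -(dvdn_pcharf (pchar_Fp (isT : prime 7))).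
have c50 : 50%:~R = 1 :> 'F_7.
  have -> : 50 = 50%N%:Z by [].
  by apply/eqP; rewrite -pmulrn -subr_eq0 -[1]/(1%N%:R) -natrB // F7.
pose A : 'M['F_7]_(#|F|, 1) := \col_i (enum_val i == w)%:R.
pose B : 'M['F_7]_(#|F|, 1) := \col_i (enum_val i != w)%:R.
pose U : 'M['F_7]_(#|F|, 1 + 1) := row_mx A B.
have ME : map_mx intr (fixed_mx x (moore_kernel (G := G))) = U *m - U^T.
  rewrite mulmxN tr_row_mx mul_row_col.
  apply/matrixP => i j; rewrite !mxE !big_ord1 !mxE.
  have iF := enum_valP i; have jF := enum_valP j.
  have -> : (moore_kernel (enum_val i) (enum_val j))%:~R =
      (adj (enum_val i) (enum_val j))%:R - 1 :> 'F_7.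
    by rewrite /moore_kernel intrB intrM c50 mul1r mulr1z -pmulrn.
  have [iw|iw] := eqVneq (enum_val i) w; have [jw|jw] := eqVneq (enum_val j) w.
  - by rewrite iw jw adj_irrefl /=; ring.
  - by rewrite iw adj_sym (adjw _ jF jw) /=; ring.
  - by rewrite jw (adjw _ iF iw) /=; ring.
  have -> : adj (enum_val i) (enum_val j) = false.
    by apply: (triangle_free moore (u := w)); rewrite adj_sym adjw.
  by rewrite /=; ring.
have c350 : 350%:~R = 0 :> 'F_7.
  have -> : 350 = 350%N%:Z by [].
  by apply/eqP; rewrite -pmulrn F7.
have c400 : (- 400)%:~R != 0 :> 'F_7.
  have -> : - 400 = - (400%N%:Z) by [].
  by rewrite mulrNz oppr_eq0 -pmulrn F7.
have := char_poly_mulmxC U (- U^T); rewrite -ME cE c350 subr0.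
move: (- 400)%:~R c400 => c c_neq0.
set Q := char_poly _; have Q0 : Q != 0 by rewrite monic_neq0 ?char_poly_monic.
move/(congr1 (mup 0)).
have Xn0 n : 'X ^+ n != 0 :> {poly 'F_7} by rewrite expf_neq0 ?polyX_eq0.
have Xc0 n : ('X - c%:P) ^+ n != 0 by rewrite expf_neq0 ?polyXsubC_eq0.
have mupX n : mup 0 ('X ^+ n : {poly 'F_7}) = n.
  by have := mup_XsubCX n 0 (0 : 'F_7); rewrite eqxx subr0.
rewrite (mupM 0 (mulf_neq0 (Xn0 al) (Xc0 be)) (Xn0 _)).
rewrite (mupM 0 (Xn0 al) (Xc0 be)) (mupM 0 (Xn0 _) Q0) !mupX.
rewrite mup_XsubCX (negPf c_neq0) addn0 => ->.
by rewrite leq_addr.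
Qed.

End Star.

(** * The four primes *)

Section Cases.

Variable G : sgraph.
Hypothesis moore : moore_diameter2 G 57.
Variable x : {perm G}.
Hypothesis autx : x \in graph_aut G.

Lemma displaced_19 : #[x]%g = 19 -> 'a_0 x = 1 /\ 'a_1 x = 57.
Proof.
move=> ox; have p_pr : prime 19 by [].
rewrite displaced0 // displaced1 //.
have [al [be [abE _ /(_ 1 isT) tE]]] := shifted_trace moore autx p_pr ox isT.
have F0 : fixv x != set0.
  exact: (fixv_neq0 moore p_pr ox isT).
have F1 : #|fixv x| = 1.
  have [/existsP[u /andP[uF u0]]|/existsPn no] :=
      boolP [exists u in fixv x, degree_in (fixv x) u == 0].
    rewrite (card_closed moore (fixv_closed moore autx) uF).
    by move: u0; rewrite cards_eq0 => /eqP ->; rewrite big_set0.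
  have [|d [_ _ _ [d2 d8 dm]]] := fixv_regular moore autx p_pr ox F0.
    move=> u uF; have := no u; rewrite uF /=.
    have := degree_in_fixv_mod moore autx p_pr ox uF.
    by case: (degree_in _ u) => [|[|n]].
  by case: d d2 d8 dm => [|[|[|[|[|[|[|[|[|n]]]]]]]]].
have := shifted_dvd autx p_pr ox 1; rewrite F1 in abE tE *.
by case: al abE tE => [|[|al]]; lia.
Qed.

Lemma displaced_11 : #[x]%g = 11 -> 'a_0 x = 5 /\ 'a_1 x = 55.
Proof.
move=> ox; have p_pr : prime 11 by [].
rewrite displaced0 // displaced1 //.
have [al [be [abE _ /(_ 1 isT) tE]]] := shifted_trace moore autx p_pr ox isT.
have F0 : fixv x != set0.
  exact: (fixv_neq0 moore p_pr ox isT).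
have F5 : #|fixv x| = 5.
  have [|d [_ -> _ [d2 d8 dm]]] := fixv_regular moore autx p_pr ox F0.
    move=> u /(degree_in_fixv_mod moore autx p_pr ox).
    by case: (degree_in _ u) => [|[|n]].
  by case: d d2 d8 dm => [|[|[|[|[|[|[|[|[|n]]]]]]]]].
have := shifted_dvd autx p_pr ox 1; rewrite F5 in abE tE *.
by case/dvdnP => m mE; lia.
Qed.

Lemma displaced_13 : #[x]%g = 13 -> 'a_0 x = 0 /\ 'a_1 x = 65.
Proof.
move=> ox; have p_pr : prime 13 by [].
rewrite displaced0 // displaced1 //.
have [al [be [abE _ /(_ 1 isT) tE]]] := shifted_trace moore autx p_pr ox isT.
have F0 : #|fixv x| = 0.
  apply/eqP; rewrite cards_eq0; apply/negP => /negP F0.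
  have [|d [degF cF _ [d2 d8 dm]]] := fixv_regular moore autx p_pr ox F0.
    move=> u /(degree_in_fixv_mod moore autx p_pr ox).
    by case: (degree_in _ u) => [|[|n]].
  have d5 : d = 5 by case: d d2 d8 dm {degF cF} => [|[|[|[|[|[|[|[|[|n]]]]]]]]].
  rewrite d5 in degF cF.
  have := closed_degree5_dvd11 moore (fixv_closed moore autx) degF.
  by rewrite cF.
by rewrite F0 in abE tE *; lia.
Qed.

Lemma displaced_7 : #[x]%g = 7 ->
  'a_0 x \in [:: 2; 9; 16; 23; 30; 37] /\ 'a_1 x = 7 * 'a_0 x + 35.
Proof.
move=> ox; have p_pr : prime 7 by [].
rewrite displaced0 // displaced1 //.
have [al [be [abE cE tE]]] := shifted_trace moore autx p_pr ox isT.
have a1E := tE 1 isT.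
have Fm := card_fixv_mod moore p_pr ox.
have F0 : fixv x != set0.
  exact: (fixv_neq0 moore p_pr ox isT).
have farE := card_far_from_fixv moore x.
have [/existsP[u /andP[uF /eqP u1]]|/existsPn no] :=
    boolP [exists u in fixv x, degree_in (fixv x) u == 1]; last first.
  have [|d [_ cF bF [d2 d8 dm]]] := fixv_regular moore autx p_pr ox F0.
    move=> u uF; have := no u; rewrite uF /=.
    have := degree_in_fixv_mod moore autx p_pr ox uF.
    by case: (degree_in _ u) => [|[|n]].
  (* 65 fixed vertices and 65 * 49 boundary vertices are already 3250 vertices, so
     that no vertex is adjacent to its image; but 8 * 65 - 65 is not a multiple of
     15. *)
  have dE : d = 8 by case: d d2 d8 dm {cF bF} => [|[|[|[|[|[|[|[|[|n]]]]]]]]].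
  rewrite dE in cF bF; have := subset_leq_card (shifted_far_from_fixv moore autx 1).
  lia.
have [w wF [cF adjw deg1]] := star_center moore autx uF u1.
have al_ge := star_multiplicity moore wF adjw cE.
have /dvdnP[m mE] := shifted_dvd autx p_pr ox 1.
have alE : #|fixv x| = al + 2 by lia.
have a1 : #|shifted x 1| = 7 * #|fixv x| + 35 by lia.
split=> //.
have bE := card_boundary moore (fixv_closed moore autx).
have degE : \sum_(v in fixv x) degree_in (fixv x) v = 2 * (#|fixv x|).-1.
  rewrite (bigD1 w) //= (eq_bigr (fun _ => 1)) => [|v /andP[vF vw]]; last exact: deg1.
  have := cF; rewrite (cardD1 w) wF add1n => -[cFw].
  rewrite sum1_card succnK mul2n -addnn -cFw; congr (_ + _).
  by apply: eq_card => v; rewrite !inE unfold_in inE andbC.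
have s2 := tE 2 isT; have s3 := tE 3 isT.
have dis i j := @shifted_disjoint G moore x autx 7 p_pr ox i j.
have d12 : [disjoint shifted x 2 & shifted x 1] by apply: dis.
have d13 : [disjoint shifted x 3 & shifted x 1] by apply: dis.
have d23 : [disjoint shifted x 3 & shifted x 2] by apply: dis.
have le3 : #|shifted x 3| + (#|shifted x 2| + #|shifted x 1|) <= #|far_from_fixv x|.
  have <- : #|shifted x 3 :|: (shifted x 2 :|: shifted x 1)| =
      #|shifted x 3| + (#|shifted x 2| + #|shifted x 1|).
    rewrite cardsU disjoint_setI0 ?cards0 ?subn0; last first.
      by rewrite -setI_eq0 setIUr !disjoint_setI0 // setU0.
    by rewrite cardsU (disjoint_setI0 d12) cards0 subn0.
  by rewrite subset_leq_card // !subUset !shifted_far_from_fixv.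
(* The vertices far from the star number 3248 - 56 a_0, and three disjoint sets of
   size 7 a_0 + 35 lie among them. *)
have le40 : #|fixv x| < 41.
  by clear - a1 a1E s2 s3 farE bE degE le3; lia.
have : all (fun n => (n %% 7 == 3250 %% 7) ==> (n \in [:: 2; 9; 16; 23; 30; 37]))
  (iota 0 41) by [].
by move/allP/(_ #|fixv x|); rewrite mem_iota le40 Fm eqxx => /(_ isT).
Qed.

End Cases.

Theorem theorem1p2 (G : sgraph) (hG : moore_diameter2 G 57)
    (x : {perm G}) (hx : x \in graph_aut G) (p : nat) (hp : prime p)
    (hp4 : p \in [:: 7; 11; 13; 19]) (hord : #[x]%g = p) :
  [/\ p = 7 -> 'a_0 x \in [:: 2; 9; 16; 23; 30; 37]
               /\ 'a_1 x = 7 * 'a_0 x + 35,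
      p = 11 -> 'a_0 x = 5 /\ 'a_1 x = 55,
      p = 13 -> 'a_0 x = 0 /\ 'a_1 x = 65
    & p = 19 -> 'a_0 x = 1 /\ 'a_1 x = 57].
Proof.
by split=> pE; rewrite pE in hord;
  [exact: displaced_7 | exact: displaced_11 | exact: displaced_13 | exact: displaced_19].
Qed.
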